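(* Let $H$ be a Hilbert space and $(e_j)_{j\in J}$ a family of pairwise orthogonal projections in $B(H)$ whose strong operator sum is $I_{B(H)}$. Let $S=(s_{ij})_{i,j\in J}$ be a matrix of complex scalars and let $A=(a_{ij})_{i,j\in J}$ be a matrix with $a_{ij}\in e_iB(H)e_j$ for all $i,j\in J$. If $S$ is row bounded and $A$ is column bounded, then the Schur product $S*A=(s_{ij}a_{ij})_{i,j\in J}$ is bounded and $\|S*A\|\le\|S\|_r\,\|A\|_c$.
   Context: A matrix $X=(x_{ij})_{i,j\in J}$ with $x_{ij}\in e_iB(H)e_j$ is called bounded if there is a bounded operator $y$ on $H$ with $x_{ij}=e_iye_j$ for all $i,j$; then $\|X\|:=\|y\|$. The scalar matrix $S$ is row bounded if there is $C\ge0$ such that $\sum_{j\in J_0}|s_{ij}|^2\le C^2$ for all $i\in J$ and all finite $J_0\subseteq J$; the row norm $\|S\|_r$ is the least such $C$. The matrix $A$ is column bounded if there is $C\ge0$ such that $\big\|\sum_{i\in J_0}a_{ij}^*a_{ij}\big\|\le C^2$ for all $j\in J$ and all finite $J_0\subseteq J$; the column norm $\|A\|_c$ is the least such $C$. *)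

(* Defs.v *)
From HB Require Import structures.
From mathcomp Require Import all_boot all_order all_algebra finmap.
From mathcomp Require Export all_classical all_reals all_analysis.
From mathcomp Require Export complex.
From mathcomp.analysis.showcase Require Import summability.

Set Implicit Arguments.
Unset Strict Implicit.
Unset Printing Implicit Defensive.

Import Order.TTheory GRing.Theory Num.Theory numFieldNormedType.Exports.

Local Open Scope classical_set_scope.
Local Open Scope ring_scope.
Local Open Scope complex_scope.

(* Complex Hilbert spaces. The inner product is linear in its first argument
   and conjugate-linear in its second one. *)
HB.mixin Record NormedModule_hasInner (R : realType) H
    & NormedModule R[i] H := {
  inner : {dot H for (@Num.conj R[i])} ;
  sqr_norm_inner : forall x : H, `|x| ^+ 2 = inner x x
}.

#[short(type="hilbertType")]
HB.structure Definition Hilbert (R : realType) :=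
  {H of CompleteNormedModule R[i] H & NormedModule_hasInner R H}.

Section Operators.
Context {R : realType} {H : hilbertType R}.
Implicit Types p q y : H -> H.

Definition bounded_op : set (H -> H) :=
  [set y | linear y /\ exists M : R, forall x, `|y x| <= M%:C * `|x|].

Definition op_norm y : R :=
  inf [set M : R | 0 <= M /\ forall x, `|y x| <= M%:C * `|x|].

(* For bounded y, the vector w below exists for every v by the Riesz
   representation theorem, and is unique. *)
Definition adjoint y : H -> H :=
  fun v => get [set w : H | forall u, inner (y u) v = inner u w].

Definition is_projection p : Prop :=
  [/\ bounded_op p, p \o p = p & adjoint p = p].

(* p B(H) q *)
Definition corner p q : set (H -> H) :=
  [set p \o y \o q | y in bounded_op].

End Operators.

Section OperatorMatrices.
Context {R : realType} {H : hilbertType R} {J : choiceType}.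
Implicit Types (e : J -> H -> H) (S : J -> J -> R[i]) (X A : J -> J -> H -> H).

Definition pairwise_orthogonal_projections e : Prop :=
  (forall j, is_projection (e j)) /\
  (forall i j, i != j -> e i \o e j = (0 : H -> H)).

(* totally is the filter of the finite subsets of J directed by inclusion. *)
Definition strong_sum e (y : H -> H) : Prop :=
  forall x, partial_sum (e ^~ x) @ totally --> y x.

Definition represents e X : set (H -> H) :=
  [set y | bounded_op y /\ forall i j, X i j = e i \o y \o e j].

Definition bounded_mx e X : Prop := exists y, represents e X y.

(* When the e j sum strongly to the identity, X is represented by at most one
   operator. *)
Definition mx_norm e X : R := op_norm (get (represents e X)).

Definition row_bounds S : set R :=
  [set C | 0 <= C /\ forall (i : J) (J0 : {fset J}),
     \sum_(j <- J0) `|S i j| ^+ 2 <= (C ^+ 2)%:C].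

Definition row_bounded S : Prop := exists C, row_bounds S C.

Definition row_norm S : R := inf (row_bounds S).

Definition col_bounds A : set R :=
  [set C | 0 <= C /\ forall (j : J) (J0 : {fset J}),
     op_norm (\sum_(i <- J0) (adjoint (A i j) \o A i j : H -> H)) <= C ^+ 2].

Definition col_bounded A : Prop := exists C, col_bounds A C.

Definition col_norm A : R := inf (col_bounds A).

Definition schur_product S A : J -> J -> H -> H :=
  fun i j => S i j *: A i j.

End OperatorMatrices.

(* Main.v *)
(* The truncations B_F = \sum_(i, j in F) s_ij a_ij, for F a finite set of
   indices, are uniformly bounded: the ranges of the e_i being orthogonal,
     |B_F x|^2 = \sum_i |\sum_j s_ij a_ij x|^2
              <= \sum_i (\sum_j |s_ij|^2) (\sum_j |a_ij e_j x|^2)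
              <= |S|_r^2 \sum_j |A|_c^2 |e_j x|^2 <= (|S|_r |A|_c |x|)^2.
   They therefore converge strongly as soon as they converge on the vectors
   with finitely many nonzero coordinates, and the limit represents S * A. The
   column norm involves the adjoints of the a_ij, which exist by the Riesz
   representation theorem, itself obtained by minimising |x|^2 - 2 Re (f x). *)
Require Import Defs.
From mathcomp Require Import all_boot all_order all_algebra finmap.
From mathcomp Require Import lra ring.
From mathcomp.analysis.showcase Require Import summability.

Set Implicit Arguments.
Unset Strict Implicit.
Unset Printing Implicit Defensive.

Import Order.TTheory GRing.Theory Num.Theory numFieldNormedType.Exports.

Local Open Scope classical_set_scope.
Local Open Scope ring_scope.
Local Open Scope complex_scope.

(** * Real-valued norms *)

Section RealNorm.
Context {R : realType} {V : normedZmodType R[i]}.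
Implicit Types x y : V.

(** Norms of [V] take values in [R[i]], whose order is only partial; the real part moves estimates
    to [R], where the order is total and [lra] and [nra] apply. *)
Definition rnorm x : R := complex.Re `|x|.

Lemma rnormE x : `|x| = (rnorm x)%:C.
Proof. by rewrite /rnorm RRe_real ?normr_real. Qed.

Lemma rnorm_ge0 x : 0 <= rnorm x.
Proof. by rewrite -lecR -rnormE normr_ge0. Qed.

Lemma rnorm0 : rnorm 0 = 0. Proof. by rewrite /rnorm normr0. Qed.

Lemma rnorm_eq0 x : rnorm x = 0 -> x = 0.
Proof. by move=> x0; apply/normr0_eq0; rewrite rnormE x0. Qed.

Lemma rnormN x : rnorm (- x) = rnorm x.
Proof. by rewrite /rnorm normrN. Qed.

Lemma ler_rnormD x y : rnorm (x + y) <= rnorm x + rnorm y.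
Proof. by rewrite -lecR rmorphD /= -!rnormE ler_normD. Qed.

Lemma ler_rnormB x y : rnorm (x - y) <= rnorm x + rnorm y.
Proof. by rewrite -(rnormN y) ler_rnormD. Qed.

Lemma ler_rnorm_sum (I : Type) (s : seq I) (F : I -> V) :
  rnorm (\sum_(i <- s) F i) <= \sum_(i <- s) rnorm (F i).
Proof.
elim/big_rec2: _ => [|i a b _ H]; first by rewrite rnorm0.
by rewrite (le_trans (ler_rnormD _ _)) ?lerD2l.
Qed.

End RealNorm.

Lemma rnormZ {R : realType} {V : normedModType R[i]} (c : R[i]) (x : V) :
  rnorm (c *: x) = rnorm c * rnorm x.
Proof. by apply: complexI; rewrite rmorphM /= -!rnormE normrZ. Qed.

Lemma ler_Re_rnorm {R : realType} (c : R[i]) : complex.Re c <= rnorm c.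
Proof.
case: c => a b; rewrite /rnorm normc_def /=.
rewrite (le_trans (ler_norm a)) // -sqrtr_sqr ler_wsqrtr // lerDl sqr_ge0 //.
Qed.

(** * Algebra of the inner product *)

Section Inner.
Context {R : realType} {H : hilbertType R}.
Implicit Types (x y z u v w : H) (c : R[i]).

Lemma innerDl x y z : inner (x + y) z = inner x z + inner y z.
Proof. exact: linearDl. Qed.

Lemma innerDr x y z : inner z (x + y) = inner z x + inner z y.
Proof. exact: linearDr. Qed.

Lemma innerZl c x z : inner (c *: x) z = c * inner x z.
Proof. exact: linearZl_LR. Qed.

Lemma innerZr c x z : inner z (c *: x) = Num.conj c * inner z x.
Proof. exact: linearZr_LR. Qed.

Lemma innerC x y : inner x y = Num.conj (inner y x).
Proof. by rewrite hermC expr0 mul1r. Qed.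

Lemma innerNr x z : inner z (- x) = - inner z x.
Proof. exact: linearNr. Qed.

Lemma innerBr x y z : inner z (x - y) = inner z x - inner z y.
Proof. by rewrite innerDr innerNr. Qed.

Lemma inner0l z : inner 0 z = 0 :> R[i].
Proof. exact: linear0l. Qed.

Lemma inner0r z : inner z 0 = 0 :> R[i].
Proof. exact: linear0r. Qed.

Lemma inner_suml (I : Type) (s : seq I) (F : I -> H) z :
  inner (\sum_(i <- s) F i) z = \sum_(i <- s) inner (F i) z.
Proof. exact: linear_sumlz. Qed.

Lemma inner_sumr (I : Type) (s : seq I) (F : I -> H) z :
  inner z (\sum_(i <- s) F i) = \sum_(i <- s) inner z (F i).
Proof. exact: linear_sumr. Qed.

Lemma innerxx x : inner x x = (rnorm x ^+ 2)%:C.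
Proof. by rewrite -sqr_norm_inner rnormE rmorphXn. Qed.

Lemma ReC c : complex.Re (Num.conj c) = complex.Re c.
Proof. by case: c. Qed.

Lemma rnormD_sqr x y :
  rnorm (x + y) ^+ 2 = rnorm x ^+ 2 + rnorm y ^+ 2 + 2 * complex.Re (inner x y).
Proof.
have -> : rnorm (x + y) ^+ 2 = complex.Re (inner (x + y) (x + y)).
  by rewrite innerxx.
rewrite innerDl !innerDr !raddfD /= (innerC y x) ReC !innerxx /=; ring.
Qed.

End Inner.

(** * Cauchy-Schwarz and completeness *)

Section Complete.
Context {R : realType} {H : hilbertType R}.
Implicit Types (x y z u v w : H) (c : R[i]).

(** This is the squared triangle inequality, compared with the expansion of |x + y|^2. *)
Lemma ler_Re_inner x y : complex.Re (inner x y) <= rnorm x * rnorm y.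
Proof.
have := ler_rnormD x y.
rewrite -(@ler_pXn2r _ 2) ?nnegrE ?addr_ge0 ?rnorm_ge0 // rnormD_sqr; nra.
Qed.

Lemma mul_conj_rnorm c : Num.conj c * c = (rnorm c ^+ 2)%:C.
Proof. by rewrite mulrC -normCK rnormE rmorphXn. Qed.

Lemma rnorm_conj c : rnorm (Num.conj c) = rnorm c.
Proof. by rewrite /rnorm norm_conjC. Qed.

Lemma rnormC (r : R) : rnorm r%:C = `|r|.
Proof. by rewrite /rnorm normc_def /= expr0n addr0 sqrtr_sqr. Qed.

(** Scaling [x] by the conjugate of c = <x, y> turns the inner product into the real number |c|^2;
    the bound on real parts is then divided by |c|. *)
Lemma cauchy_schwarz x y : rnorm (inner x y) <= rnorm x * rnorm y.
Proof.
set c : R[i] := inner x y.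
have [/eqP->|c0] := boolP (rnorm c == 0).
  by rewrite mulr_ge0 ?rnorm_ge0.
have c_gt0 : 0 < rnorm c by rewrite lt0r c0 rnorm_ge0.
have := ler_Re_inner (Num.conj c *: x) y.
rewrite innerZl -/c mul_conj_rnorm /= rnormZ rnorm_conj expr2 -mulrA.
by rewrite ler_pM2l.
Qed.

(** Completeness without sequences: [U r] is read as the set of approximations with error [r] to a
    point yet to be found. *)
Lemma complete_approx (U : R -> set H) :
  (forall r, 0 < r -> exists x, U r x) ->
  (forall r s x y,
     0 < r -> 0 < s -> U r x -> U s y -> rnorm (x - y) <= r + s) ->
  exists w, forall r x, 0 < r -> U r x -> rnorm (x - w) <= r.
Proof.
move=> U_ex U_le.
(* [U] is not assumed monotone in [r]; taking the union over all errors at most [r] makes the sets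
   nested, hence a filter base. *)
pose B r := [set z | exists2 s, 0 < s <= r & U s z].
pose F := filter_from [set r : R | 0 < r] B.
have FF : ProperFilter F.
  apply: filter_from_proper => [|r r0]; last first.
    by have [x Ux] := U_ex r r0; exists x, r; rewrite // r0 /=.
  apply: filter_from_filter => [|r s r0 s0]; first by exists 1; apply: ltr01.
  exists (Order.min r s); first by rewrite /= lt_min r0 s0.
  move=> z [t /andP[t0]]; rewrite le_min => /andP[tr ts] Uz.
  by split; exists t; rewrite // t0.
have F_cauchy : cauchy F.
  apply: cauchy_exP => eps; rewrite ltcE => /andP[/eqP eps_real eps0] /=.
  (* Points of [U r] and [U s] with s <= r = eps / 3 are at distance at most 2 eps / 3, strictly
     inside the open ball. *)
  have r0 : 0 < complex.Re eps / 3 by rewrite divr_gt0.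
  have [x Ux] := U_ex _ r0; exists x; exists (complex.Re eps / 3) => // z [s].
  move=> /andP[s0 sr] Uz; rewrite -ball_normE /= rnormE.
  rewrite ltcE /= eps_real eqxx /= (le_lt_trans (U_le _ _ _ _ r0 s0 Ux Uz)) //.
  by move: eps0 => /= eps0; lra.
have Fw : F --> lim F := cauchy_cvg F F_cauchy.
set w := lim F in Fw; exists w => r x r0 Ux; apply/ler_addgt0Pr => e e0.
have e2 : 0 < e / 2 by rewrite divr_gt0.
have Fball : F (ball w (e / 2)%:C).
  by apply: Fw; apply: nbhsx_ballx; rewrite ltcR.
have FB : F (B (e / 2)) by exists (e / 2).
have [z [wz [s /andP[s0 se] Uz]]] := filter_ex (filterI Fball FB).
move: wz; rewrite -ball_normE /= rnormE ltcR => wz.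
have -> : x - w = (x - z) - (w - z) by rewrite opprB addrA subrK.
have := ler_rnormB (x - z) (w - z); have := U_le _ _ _ _ r0 s0 Ux Uz; lra.
Qed.

End Complete.

(** * The Riesz representation theorem *)

Section Riesz.
Context {R : realType} {H : hilbertType R}.
Variables (f : H -> R[i]) (M : R).
Hypothesis f_lin : scalar f.
Hypothesis f_bnd : forall u, rnorm (f u) <= M * rnorm u.
Implicit Types (x y z u v w : H).

(** If [f] is represented by [w], this is |x - w|^2 - |w|^2, so the vector sought is its
    minimiser. *)
Let energy x : R := rnorm x ^+ 2 - 2 * complex.Re (f x).

Let fD x y : f (x + y) = f x + f y.
Proof. by rewrite -{1}(scale1r x) f_lin mul1r. Qed.

Let f0 : f 0 = 0.
Proof. by apply: (addrI (f 0)); rewrite -fD !addr0. Qed.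

Let fZ a x : f (a *: x) = a * f x.
Proof. by rewrite -(addr0 (a *: x)) f_lin f0 addr0. Qed.

Let energy_lb x : - M ^+ 2 <= energy x.
Proof.
have := ler_Re_rnorm (f x); have := f_bnd x; rewrite /energy.
have := sqr_ge0 (rnorm x - M); nra.
Qed.

Let energyD x u c :
  energy (x + c *: u) =
    energy x + rnorm c ^+ 2 * rnorm u ^+ 2
    + 2 * complex.Re (c * (inner u x - f u)).
Proof.
rewrite /energy rnormD_sqr rnormZ fD fZ innerC ReC innerZl mulrBr.
by rewrite !raddfD /= raddfN /=; ring.
Qed.

(* A near-minimiser of the energy is tested against its perturbation along
   each direction u. *)
Let riesz_approx r : 0 < r ->
  exists x, forall u, rnorm (inner u x - f u) <= r * rnorm u.
Proof.
move=> r0.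
have E_inf : has_inf (range energy).
  split; first by exists (energy 0), 0.
  by exists (- M ^+ 2) => _ [x _ <-]; exact: energy_lb.
have [_ [x _ <-] x_min] := inf_adherent (exprn_gt0 2 r0) E_inf.
exists x => u; set c := inner u x - f u.
have [/rnorm_eq0 u0|u0] := eqVneq (rnorm u) 0.
  by rewrite /c u0 inner0l f0 subrr !rnorm0 mulr0.
have {}u0 : 0 < rnorm u by rewrite lt0r u0 rnorm_ge0.
(* The coefficient t = - s conj(c), with s = 1 / |u|^2, is the optimal perturbation along [u]: it
   changes the energy by exactly - |c|^2 / |u|^2. As [x] is within r^2 of the infimum, this forces
   |c| <= r |u|. *)
pose s : R := (rnorm u ^+ 2)^-1.
have su : s * rnorm u ^+ 2 = 1 by rewrite mulVf // expf_neq0 // gt_eqF.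
have s0 : 0 <= s by rewrite invr_ge0 sqr_ge0.
have := ge_inf E_inf.2 (imageT energy (x + ((- s)%:C * Num.conj c) *: u)).
have Re_tc : complex.Re ((- s)%:C * Num.conj c * c) = - s * rnorm c ^+ 2.
  by rewrite -mulrA mul_conj_rnorm -rmorphM.
have norm_t : rnorm ((- s)%:C * Num.conj c) = s * rnorm c.
  apply: complexI; rewrite rmorphM /= -rnormE normrM !rnormE rnormC rnorm_conj.
  by rewrite normrN ger0_norm.
rewrite energyD -/c Re_tc norm_t => le_m.
have sq_t : (s * rnorm c) ^+ 2 * rnorm u ^+ 2 = s * rnorm c ^+ 2.
  by rewrite exprMn [s ^+ 2]expr2 mulrAC -(mulrA s s) su mulr1.
rewrite -(@ler_pXn2r _ 2) ?nnegrE ?mulr_ge0 ?rnorm_ge0 ?(ltW r0) // exprMn.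
have le_r : s * rnorm c ^+ 2 <= r ^+ 2 by lra.
have -> : rnorm c ^+ 2 = s * rnorm c ^+ 2 * rnorm u ^+ 2.
  by rewrite mulrAC su mul1r.
by rewrite ler_wpM2r ?sqr_ge0.
Qed.

Lemma riesz : exists w, forall u, f u = inner u w.
Proof.
pose U r := [set x : H | forall u, rnorm (inner u x - f u) <= r * rnorm u].
have U_le r s x y : 0 < r -> 0 < s -> U r x -> U s y -> rnorm (x - y) <= r + s.
  (* Both approximate representers are tested on their own difference, where their values differ by
     |x - y|^2. *)
  move=> r0 s0 /(_ (x - y)) Ux /(_ (x - y)) Uy.
  have [->|xy0] := eqVneq (rnorm (x - y)) 0; first by rewrite addr_ge0 ?ltW.
  have {}xy0 : 0 < rnorm (x - y) by rewrite lt0r xy0 rnorm_ge0.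
  rewrite -(ler_pM2r xy0) mulrDl (le_trans _ (lerD Ux Uy)) //.
  rewrite (le_trans _ (ler_rnormB _ _)) // opprB addrA subrK -innerBr innerxx.
  by rewrite rnormC ger0_norm ?sqr_ge0 // expr2.
have [w Uw] := complete_approx riesz_approx U_le.
exists w => u; apply/eqP; rewrite eq_sym -subr_eq0; apply/eqP/rnorm_eq0.
apply/le_anti; rewrite rnorm_ge0 andbT; apply/ler_addgt0Pr => e e0; rewrite add0r.
(* Two errors of size r |u| occur: one from the approximate representer [x], one from |x - w| <= r.
   Adding 1 keeps the denominator positive when [u] is zero. *)
pose r := e / (2 * (rnorm u + 1)).
have u1 : 0 < rnorm u + 1 by rewrite ltr_wpDl ?rnorm_ge0.
have r0 : 0 < r by rewrite divr_gt0 // mulr_gt0.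
have [x Ux] := riesz_approx r0.
have := cauchy_schwarz u (x - w); have := ler_wpM2l (rnorm_ge0 u) (Uw _ _ r0 Ux).
have := ler_rnormB (inner u x - f u) (inner u (x - w)); have := Ux u.
have -> : inner u x - f u - inner u (x - w) = inner u w - f u.
  by rewrite innerBr; ring.
have : 2 * r * (rnorm u + 1) = e by rewrite /r; field; rewrite gt_eqF.
have := rnorm_ge0 u; nra.
Qed.

End Riesz.

(** * Bounded operators and their adjoints *)

Section Operators.
Context {R : realType} {H : hilbertType R}.
Implicit Types (x z u v w : H) (y : H -> H) (c : R[i]).

Lemma inner_ext v w : (forall u, inner u v = inner u w) -> v = w.
Proof.
move=> vw; apply/eqP; rewrite -subr_eq0; apply/eqP/rnorm_eq0.
have /complexI/eqP : (rnorm (v - w) ^+ 2)%:C = 0%:C :> R[i].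
  by rewrite -innerxx innerBr vw subrr.
by rewrite sqrf_eq0 => /eqP.
Qed.

Lemma lin0 y : linear y -> y 0 = 0.
Proof. by move=> /(_ (- 1) 0 0); rewrite scaler0 addr0 scaleN1r addNr. Qed.

Lemma linD y u v : linear y -> y (u + v) = y u + y v.
Proof. by move=> /(_ 1 u v); rewrite !scale1r. Qed.

Lemma linZ y c u : linear y -> y (c *: u) = c *: y u.
Proof.
by move=> ylin; have := ylin c u 0; rewrite !addr0 (lin0 ylin) addr0.
Qed.

Lemma linB y u v : linear y -> y (u - v) = y u - y v.
Proof. by move=> ylin; rewrite linD // -scaleN1r linZ // scaleN1r. Qed.

Lemma lin_sum y (I : Type) (s : seq I) (F : I -> H) :
  linear y -> y (\sum_(i <- s) F i) = \sum_(i <- s) y (F i).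
Proof.
move=> ylin; elim/big_rec2: _ => [|i a b _ <-]; first exact: lin0.
by rewrite linD.
Qed.

Lemma ler_rnormP y (M : R) x :
  (`|y x| <= M%:C * `|x|) = (rnorm (y x) <= M * rnorm x).
Proof. by rewrite !rnormE -rmorphM lecR. Qed.

Lemma bounded_opP y :
  bounded_op y <->
  linear y /\ exists2 M : R, 0 <= M & forall x, rnorm (y x) <= M * rnorm x.
Proof.
split=> -[ylin [M]] => [M_bnd|M0 M_bnd]; split=> //.
  exists `|M| => // x; have := M_bnd x; rewrite ler_rnormP => /le_trans; apply.
  by rewrite ler_wpM2r ?rnorm_ge0 // ler_norm.
by exists M => x; rewrite ler_rnormP.
Qed.

Lemma bounded_op_lin y : bounded_op y -> linear y.
Proof. by case. Qed.

Lemma bounded_op_comp y1 y2 :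
  bounded_op y1 -> bounded_op y2 -> bounded_op (y1 \o y2).
Proof.
move=> /bounded_opP[lin1 [M1 M10 M1_bnd]] /bounded_opP[lin2 [M2 M20 M2_bnd]].
apply/bounded_opP; split=> [a u v|]; first by rewrite /= lin2 lin1.
exists (M1 * M2) => [|x /=]; first by rewrite mulr_ge0.
by rewrite (le_trans (M1_bnd _)) // -mulrA ler_wpM2l.
Qed.

Lemma bounded_opZ c y : bounded_op y -> bounded_op (c *: y).
Proof.
move=> /bounded_opP[ylin [M M0 M_bnd]]; apply/bounded_opP; split=> [a u v|].
  by rewrite !scalrfctE ylin scalerDr !scalerA mulrC.
exists (rnorm c * M) => [|x]; first by rewrite mulr_ge0 ?rnorm_ge0.
by rewrite scalrfctE rnormZ -mulrA ler_wpM2l ?rnorm_ge0.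
Qed.

Lemma bounded_op_sum (I : Type) (s : seq I) (Y : I -> H -> H) :
  (forall i, bounded_op (Y i)) -> bounded_op (\sum_(i <- s) Y i).
Proof.
move=> Yb; elim/big_rec: _ => [|i y _ /bounded_opP[ylin [M M0 M_bnd]]].
  apply/bounded_opP; split=> [a u v|]; first by rewrite scaler0 addr0.
  by exists 0 => // x; rewrite mul0r rnorm0.
have /bounded_opP[ilin [N N0 N_bnd]] := Yb i.
apply/bounded_opP; split=> [a u v|].
  by rewrite /GRing.add /= ilin ylin scalerDr addrACA.
exists (N + M) => [|x]; first by rewrite addr_ge0.
by rewrite (le_trans (ler_rnormD _ _)) // mulrDl lerD.
Qed.

Lemma op_norm_le y (M : R) :
  0 <= M -> (forall x, rnorm (y x) <= M * rnorm x) -> op_norm y <= M.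
Proof.
move=> M0 M_bnd; apply: ge_inf; first by exists 0 => ? [].
by split=> // x; rewrite ler_rnormP.
Qed.

(** The infimum defining [op_norm] is itself a bound: for nonzero [x], the quotient |y x| / |x| lies
    below every admissible constant. *)
Lemma rnorm_op y x : bounded_op y -> rnorm (y x) <= op_norm y * rnorm x.
Proof.
move=> /bounded_opP[ylin [M M0 M_bnd]].
have [/rnorm_eq0->|x0] := eqVneq (rnorm x) 0.
  by rewrite lin0 // rnorm0 mulr0.
rewrite -ler_pdivrMr ?lt0r ?x0 ?rnorm_ge0 //; apply: lb_le_inf.
  by exists M; split=> // u; rewrite ler_rnormP.
move=> N [N0 /(_ x)]; rewrite ler_rnormP.
by rewrite ler_pdivrMr // lt0r x0 rnorm_ge0.
Qed.

(** Riesz, applied to the functional sending [u] to [inner (y u) v], shows that the set from which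
    [get] chooses is nonempty. *)
Lemma adjointE y u v : bounded_op y -> inner (y u) v = inner u (adjoint y v).
Proof.
move=> /bounded_opP[ylin [M M0 M_bnd]].
suff /getPex : exists w, forall u, inner (y u) v = inner u w by exact.
apply: (@riesz _ _ (fun u => inner (y u) v) (M * rnorm v)) => [a u1 u2|x].
  by rewrite ylin innerDl innerZl.
rewrite (le_trans (cauchy_schwarz _ _)) // mulrAC ler_wpM2r ?rnorm_ge0 //.
Qed.

Lemma bounded_op_adjoint y : bounded_op y -> bounded_op (adjoint y).
Proof.
move=> yb; have /bounded_opP[ylin [M M0 M_bnd]] := yb.
apply/bounded_opP; split=> [a u v|].
  apply: inner_ext => w.
  by rewrite innerDr innerZr -!adjointE // innerDr innerZr.
exists M => // v; set w := adjoint y v.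
have [->|w0] := eqVneq (rnorm w) 0; first by rewrite mulr_ge0 ?rnorm_ge0.
have {}w0 : 0 < rnorm w by rewrite lt0r w0 rnorm_ge0.
(* With [w] the image of [v] under the adjoint, |w|^2 = <y w, v> <= M |w| |v|, and |w| cancels. *)
rewrite -(ler_pM2l w0) -expr2 -[leLHS]ger0_norm ?sqr_ge0 // -rnormC -innerxx.
rewrite {2}/w -adjointE // (le_trans (cauchy_schwarz _ _)) // mulrA.
by rewrite ler_wpM2r ?rnorm_ge0 // mulrC.
Qed.

End Operators.

Lemma big_fset_if {V : nmodType} {J : choiceType} (F G : {fset J})
    (f : J -> V) :
  (F `<=` G)%fset ->
  \sum_(j <- G) (if j \in F then f j else 0) = \sum_(j <- F) f j.
Proof.
move=> FG; rewrite -(big_fset_incl _ FG) => [|j _ /negbTE-> //].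
by apply: eq_big_seq => j ->.
Qed.

(** * Finite sums of orthogonal projections *)

Section Projections.
Context {R : realType} {H : hilbertType R} {J : choiceType}.
Variable e : J -> H -> H.
Hypothesis e_proj : pairwise_orthogonal_projections e.
Implicit Types (x u v w : H) (F G : {fset J}).

Definition psum F x := \sum_(j <- F) e j x.

Lemma proj_bounded i : bounded_op (e i).
Proof. by have [] := e_proj.1 i. Qed.

Lemma proj_lin i : linear (e i).
Proof. exact: bounded_op_lin (proj_bounded i). Qed.

Lemma proj_proj i j x : e i (e j x) = if i == j then e j x else 0.
Proof.
case: eqVneq => [->|/e_proj.2 /(congr1 (@^~ x))//].
by have [_ /(congr1 (@^~ x))] := e_proj.1 j.
Qed.

Lemma proj_sym i u v : inner (e i u) v = inner u (e i v).
Proof. by have [b _ {2}<-] := e_proj.1 i; rewrite adjointE. Qed.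

Lemma proj_psum i F x : e i (psum F x) = if i \in F then e i x else 0.
Proof.
rewrite (lin_sum _ _ (proj_lin i)); under eq_bigr => j _ do rewrite proj_proj.
case: ifPn => [iF|iF].
  rewrite (big_fsetD1 i) //= eqxx big1_seq ?addr0 // => j /=.
  by rewrite in_fsetD1 eq_sym => /andP[/negbTE->].
by rewrite big1_seq // => j /= jF; case: eqP jF iF => // -> ->.
Qed.

Lemma psum_idem F x : psum F (psum F x) = psum F x.
Proof. by apply: eq_big_seq => i iF; rewrite proj_psum iF. Qed.

Lemma psum_lin F : linear (psum F).
Proof.
move=> a u v; rewrite /psum scaler_sumr -big_split /=; apply: eq_bigr => i _.
exact: proj_lin.
Qed.

Lemma psum_sym F u v : inner (psum F u) v = inner u (psum F v).
Proof.
by rewrite inner_suml inner_sumr; apply: eq_bigr => i _; rewrite proj_sym.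
Qed.

(** [psum F] is symmetric and idempotent, so the cross term <P x, x - P x> = <x, P x - P x>
    vanishes. *)
Lemma psum_pythagoras F x :
  rnorm x ^+ 2 = rnorm (psum F x) ^+ 2 + rnorm (x - psum F x) ^+ 2.
Proof.
rewrite -{1}(subrKC (psum F x) x) (rnormD_sqr (psum F x)).
rewrite psum_sym linB; last exact: psum_lin.
by rewrite psum_idem subrr inner0r mulr0 addr0.
Qed.

Lemma rnorm_psum_le F x : rnorm (psum F x) <= rnorm x.
Proof.
rewrite -(@ler_pXn2r _ 2) ?nnegrE ?rnorm_ge0 // [leRHS](psum_pythagoras F).
by rewrite lerDl sqr_ge0.
Qed.

(** The hypothesis places [v i] in the range of [e i]. Hence [e i] extracts [v i] from the sum s,
    and <s, v i> = <e i s, v i> = |v i|^2. *)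
Lemma rnorm_sum_orthogonal F (v : J -> H) : (forall i, e i (v i) = v i) ->
  rnorm (\sum_(i <- F) v i) ^+ 2 = \sum_(i <- F) rnorm (v i) ^+ 2.
Proof.
move=> ev; set s := \sum_(i <- F) v i.
have es i : i \in F -> e i s = v i.
  move=> iF; rewrite (lin_sum _ _ (proj_lin i)) (big_fsetD1 i) //= ev.
  rewrite big1_seq ?addr0 // => j.
  rewrite in_fsetD1 eq_sym => /andP[_ /andP[ij _]].
  by rewrite -ev proj_proj (negbTE ij).
apply: complexI; rewrite -innerxx {2}/s inner_sumr rmorph_sum.
apply: eq_big_seq => i iF; rewrite -{1}(ev i) -proj_sym es //= innerxx //.
Qed.

Lemma rnorm_psum F x : \sum_(i <- F) rnorm (e i x) ^+ 2 = rnorm (psum F x) ^+ 2.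
Proof. by rewrite rnorm_sum_orthogonal // => i; rewrite proj_proj eqxx. Qed.

Lemma psum_cvg x (r : R) : strong_sum e idfun -> 0 < r ->
  exists F, forall G, (F `<=` G)%fset -> rnorm (x - psum G x) <= r.
Proof.
move=> e_sum r0.
have : nbhs x (ball x r%:C) by apply: nbhsx_ballx; rewrite ltcR.
move=> /(e_sum x)[F _ FU]; exists F => G /FU.
rewrite /= -ball_normE /= rnormE ltcR /partial_sum /psum big_seq_fsetE /=.
exact: ltW.
Qed.

End Projections.

(** * Operators obtained from uniformly bounded truncations *)

Section Truncations.
Context {R : realType} {H : hilbertType R} {J : choiceType}.
Variables (e : J -> H -> H) (X : J -> J -> H -> H) (K : R).
Hypothesis e_proj : pairwise_orthogonal_projections e.
Hypothesis e_sum : strong_sum e idfun.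
Hypothesis X_lin : forall i j, linear (X i j).
Hypothesis X_corner : forall i j x, e i (X i j (e j x)) = X i j x.
Implicit Types (x u v w : H) (F G : {fset J}).

(** Rows and columns are truncated separately: for an input with finitely many coordinates, the
    columns stay fixed while the rows grow. *)
Definition block F G x := \sum_(i <- F) \sum_(j <- G) X i j x.

Local Notation P := (psum e).

Lemma corner_projl k i j x : e k (X i j x) = if k == i then X i j x else 0.
Proof. by rewrite -X_corner proj_proj. Qed.

Lemma corner_projr i j x : X i j (e j x) = X i j x.
Proof. by rewrite -X_corner proj_proj // eqxx X_corner. Qed.

Lemma block_lin F G : linear (block F G).
Proof.
move=> a u v; rewrite /block scaler_sumr -big_split; apply: eq_bigr => i _ /=.
by rewrite scaler_sumr -big_split; apply: eq_bigr => j _; exact: X_lin.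
Qed.

(** [X i j] sees only the [j]-th coordinate of its argument, so restricting the input removes
    columns; [psum_block] is the dual fact for rows and the output. *)
Lemma block_psum F G G' x : (G' `<=` G)%fset ->
  block F G (P G' x) = block F G' x.
Proof.
move=> G'G; apply: eq_bigr => i _; rewrite -[RHS](big_fset_if _ G'G).
apply: eq_bigr => j _; rewrite -corner_projr proj_psum //.
by case: ifP; rewrite ?corner_projr // lin0.
Qed.

Lemma psum_block F F' G x : (F' `<=` F)%fset ->
  P F' (block F G x) = block F' G x.
Proof.
move=> F'F; apply: eq_big_seq => k kF'.
rewrite (lin_sum _ _ (proj_lin e_proj k)) (big_fsetD1 k) ?(fsubsetP F'F) //=.
rewrite [X in _ + X]big1_seq ?addr0 => [|i /andP[_]].
  rewrite (lin_sum _ _ (proj_lin e_proj k)); apply: eq_bigr => j _.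
  by rewrite corner_projl eqxx.
rewrite in_fsetD1 eq_sym => /andP[/negbTE ki _].
rewrite (lin_sum _ _ (proj_lin e_proj k)) big1 // => j _.
by rewrite corner_projl ki.
Qed.

Hypothesis K_ge0 : 0 <= K.
Hypothesis block_bound : forall F x, rnorm (block F F x) <= K * rnorm x.

(* On a vector supported in finitely many coordinates, the truncations are
   successive orthogonal projections of each other, so their norms increase to
   a finite supremum and control the increments. *)
Lemma block_cauchy_psum F0 x (r : R) : 0 < r ->
  exists F1, forall G, (F1 `<=` G)%fset ->
    rnorm (block G G (P F0 x) - block F1 F0 x) <= r.
Proof.
move=> r0.
pose E := [set rnorm (block F F0 x) ^+ 2 | F in [set F | (F0 `<=` F)%fset]].
have E_sup : has_sup E.
  split.
    by exists (rnorm (block F0 F0 x) ^+ 2), F0; rewrite //= fsubset_refl.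
  exists ((K * rnorm (P F0 x)) ^+ 2) => _ [F F0F <-].
  rewrite ler_pXn2r ?nnegrE ?mulr_ge0 ?rnorm_ge0 //.
  by rewrite -(block_psum _ _ F0F) block_bound.
have [_ [F1 F01 <-] F1_sup] := sup_adherent (exprn_gt0 2 r0) E_sup.
exists F1 => G F1G; have F0G := fsubset_trans F01 F1G.
(* The increment becomes [block G F0 x] minus its projection by [psum F1]; by Pythagoras its squared
   norm is a difference of two squared norms, at most [sup E] minus a number above
   [sup E - r ^+ 2]. *)
rewrite (block_psum _ _ F0G) -(psum_block _ _ F1G).
rewrite -(@ler_pXn2r _ 2) ?nnegrE ?rnorm_ge0 ?(ltW r0) //.
have := psum_pythagoras e_proj F1 (block G F0 x); rewrite psum_block //.
have : rnorm (block G F0 x) ^+ 2 <= sup E.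
  by apply: ub_le_sup; [exact: E_sup.2|exists G].
by lra.
Qed.

Lemma block_approx x (r : R) : 0 < r ->
  exists z F1, forall G, (F1 `<=` G)%fset -> rnorm (block G G x - z) <= r.
Proof.
(* Of r = s (K + 1), the part K s pays for replacing [x] by a finite partial sum, and s for the
   increment of the truncations. *)
move=> r0; pose s := r / (K + 1).
have K1 : 0 < K + 1 by rewrite ltr_wpDl.
have s0 : 0 < s by rewrite divr_gt0.
have [F0 /(_ F0 (fsubset_refl _)) xF0] := psum_cvg x e_sum s0.
have [F1 F1_le] := block_cauchy_psum F0 x s0.
exists (block F1 F0 x), F1 => G /F1_le.
set p := P F0 x in xF0 *; set z := block F1 F0 x => pz.
have -> : block G G x - z = block G G (x - p) + (block G G p - z).
  by rewrite linB ?addrA ?subrK //; exact: block_lin.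
rewrite (le_trans (ler_rnormD _ _)) //.
have := le_trans (block_bound G (x - p)) (ler_wpM2l K_ge0 xF0).
have : s * (K + 1) = r by rewrite divfK // gt_eqF.
lra.
Qed.

(** Eventual approximants are compared through the truncation at the union of their two index sets,
    so [complete_approx] yields the limit. *)
Lemma block_limit x : exists w, forall r : R, 0 < r ->
  exists F1, forall G, (F1 `<=` G)%fset -> rnorm (block G G x - w) <= r.
Proof.
pose U r := [set z | exists F1, forall G, (F1 `<=` G)%fset ->
  rnorm (block G G x - z) <= r].
have [r r0|r s z z' r0 s0 [F zF] [F' zF']|w Uw] := @complete_approx _ _ U.
- exact: block_approx.
- have := zF (F `|` F')%fset (fsubsetUl _ _).
  have := zF' (F `|` F')%fset (fsubsetUr _ _).
  set b := block _ _ _ => bz' bz.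
  have -> : z - z' = (b - z') - (b - z) by rewrite opprB [RHS]addrC addrA subrK.
  by have := ler_rnormB (b - z') (b - z); lra.
exists w => r r0; have r2 : 0 < r / 2 by rewrite divr_gt0.
have [z [F zF]] := block_approx x r2; exists F => G /zF zG.
have zw : rnorm (z - w) <= r / 2 by apply: Uw => //; exists F.
have -> : block G G x - w = (block G G x - z) + (z - w) by rewrite addrA subrK.
by have := ler_rnormD (block G G x - z) (z - w); lra.
Qed.

(** [mx_norm] uses a representative chosen by [get], so the bound is proved for all of them.
    Compressing [z] by [psum F] on both sides gives exactly the truncation, and [z x] is recovered
    as [F] grows. *)
Lemma represents_rnorm z x : represents e X z -> rnorm (z x) <= K * rnorm x.
Proof.
move=> [/bounded_opP[zlin [M M0 z_bnd]] Xz].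
have zblock F : P F (z (P F x)) = block F F x.
  rewrite /psum (lin_sum _ _ zlin); apply: eq_bigr => i _.
  rewrite (lin_sum _ _ (proj_lin e_proj i)); apply: eq_bigr => j _.
  by rewrite Xz.
(* The error is s for truncating [z x] and M s for truncating the input; the a priori bound [M]
   affects only the choice of [s]. *)
apply/ler_addgt0Pr => r r0; pose s := r / (M + 1).
have M1 : 0 < M + 1 by rewrite ltr_wpDl.
have s0 : 0 < s by rewrite divr_gt0.
have [F1 xF1] := psum_cvg x e_sum s0.
have [F2 zF2] := psum_cvg (z x) e_sum s0.
have := xF1 (F1 `|` F2)%fset (fsubsetUl _ _).
have := zF2 (F1 `|` F2)%fset (fsubsetUr _ _).
set F := (F1 `|` F2)%fset => zF xF.
have -> : z x = (z x - P F (z x)) + P F (z (x - P F x)) + block F F x.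
  rewrite -zblock -addrA -linD; last exact: psum_lin.
  by rewrite -linD // subrK subrK.
have := ler_rnormD (z x - P F (z x) + P F (z (x - P F x))) (block F F x).
have := ler_rnormD (z x - P F (z x)) (P F (z (x - P F x))).
have := rnorm_psum_le e_proj F (z (x - P F x)).
have := le_trans (z_bnd (x - P F x)) (ler_wpM2l M0 xF).
have := block_bound F x.
have : s * (M + 1) = r by rewrite divfK // gt_eqF.
lra.
Qed.

Lemma bounded_mx_blocks : bounded_mx e X.
Proof.
have [y yP] := choice block_limit.
exists y; split.
  apply/bounded_opP; split=> [a u v|].
    apply/eqP; rewrite -subr_eq0; apply/eqP/rnorm_eq0/le_anti.
    rewrite rnorm_ge0 andbT; apply/ler_addgt0Pr => r r0; rewrite add0r.
    (* The limits at [u], [v] and [a *: u + v] contribute errors |a| s, s and s. *)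
    pose s := r / (rnorm a + 2).
    have a2 : 0 < rnorm a + 2 by rewrite ltr_wpDl ?rnorm_ge0.
    have s0 : 0 < s by rewrite divr_gt0.
    have [F1 yF1] := yP (a *: u + v) s s0.
    have [F2 yF2] := yP u s s0.
    have [F3 yF3] := yP v s s0.
    pose F := (F1 `|` (F2 `|` F3))%fset.
    have := yF1 F (fsubsetUl _ _).
    have := yF2 F (fsubset_trans (fsubsetUl _ _) (fsubsetUr _ _)).
    have := yF3 F (fsubset_trans (fsubsetUr _ _) (fsubsetUr _ _)).
    rewrite block_lin; set bu := block F F u; set bv := block F F v.
    move=> bv_le bu_le b_le.
    have -> : y (a *: u + v) - (a *: y u + y v) =
        (a *: (bu - y u) + (bv - y v)) - (a *: bu + bv - y (a *: u + v)).
      by rewrite scalerBr addrACA -opprD opprB [RHS]addrC addrA subrK.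
    have := ler_rnormB (a *: (bu - y u) + (bv - y v))
      (a *: bu + bv - y (a *: u + v)).
    have := ler_rnormD (a *: (bu - y u)) (bv - y v).
    have := ler_wpM2l (rnorm_ge0 a) bu_le; rewrite -rnormZ.
    have : s * (rnorm a + 2) = r by rewrite divfK // gt_eqF.
    lra.
  exists K => // x; apply/ler_addgt0Pr => r r0.
  have [F /(_ F (fsubset_refl _)) yF] := yP x r r0.
  have -> : y x = block F F x - (block F F x - y x).
    by rewrite opprB addrC subrK.
  by rewrite (le_trans (ler_rnormB _ _)) // lerD.
move=> i j; apply/funext => x /=.
apply/eqP; rewrite -subr_eq0; apply/eqP/rnorm_eq0/le_anti.
rewrite rnorm_ge0 andbT; apply/ler_addgt0Pr => r r0; rewrite add0r.
have [F yF] := yP (e j x) r r0.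
have := yF (F `|` [fset i; j])%fset (fsubsetUl _ _).
(* Once [G] contains both indices, the (i, j) corner of the truncation is exactly [X i j], and
   [e i], seen as a [psum] over a singleton, does not increase the error. *)
set G := (F `|` [fset i; j])%fset; apply: le_trans.
have P1 k u : e k u = P [fset k]%fset u by rewrite /psum big_seq_fset1.
have iG : ([fset i] `<=` G)%fset by rewrite fsub1set !inE eqxx orbT.
have jG : ([fset j] `<=` G)%fset by rewrite fsub1set !inE eqxx !orbT.
have -> : X i j x = P [fset i]%fset (block G G (e j x)).
  by rewrite [e j x]P1 block_psum // psum_block // /block !big_seq_fset1.
rewrite [e i _]P1 -linB; last exact: psum_lin.
exact: rnorm_psum_le.
Qed.

Lemma mx_norm_blocks : mx_norm e X <= K.
Proof.
apply: op_norm_le => // x; apply: represents_rnorm.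
by apply: getPex; exact: bounded_mx_blocks.
Qed.

End Truncations.

(** * Two real inequalities *)

(** Used for both the row and the column norm, to show that the infimum is attained: the square root
    of [f t] lies below every admissible constant, hence below their infimum. *)
Lemma inf_sqr_bounds {R : realType} (T : Type) (f : T -> R) :
  let D := [set C | 0 <= C /\ forall t, f t <= C ^+ 2] in
  D !=set0 -> D (inf D).
Proof.
move=> D D0; have inf_ge0 : 0 <= inf D by apply: lb_le_inf => // C [].
split=> // t; have sqrt_le : Num.sqrt (f t) <= inf D.
  apply: lb_le_inf => // C [C0 /(_ t) ftC].
  by rewrite -(ger0_norm C0) -sqrtr_sqr ler_wsqrtr.
have [f0|/ltW f0] := leP 0 (f t); last by rewrite (le_trans f0) ?sqr_ge0.
by rewrite -(sqr_sqrtr f0) ler_pXn2r ?nnegrE ?sqrtr_ge0.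
Qed.

Lemma sum_cauchy_schwarz {R : realFieldType} (I : Type) (s : seq I)
    (a b : I -> R) :
  (\sum_(i <- s) a i * b i) ^+ 2 <=
  (\sum_(i <- s) a i ^+ 2) * (\sum_(i <- s) b i ^+ 2).
Proof.
elim: s => [|i s IH]; first by rewrite !big_nil expr0n mulr0.
rewrite !big_cons; move: IH; set A := \sum_(j <- s) a j ^+ 2.
set B := \sum_(j <- s) b j ^+ 2; set t := \sum_(j <- s) a j * b j => IH.
have A0 : 0 <= A by apply: sumr_ge0 => j _; exact: sqr_ge0.
have B0 : 0 <= B by apply: sumr_ge0 => j _; exact: sqr_ge0.
(* With p = a^2 B and q = b^2 A, the induction hypothesis bounds the square of the left side by 4 p
   q, which is at most (p + q)^2. *)
have cross : 2 * (a i * b i * t) <= a i ^+ 2 * B + b i ^+ 2 * A.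
  have p0 : 0 <= a i ^+ 2 * B by rewrite mulr_ge0 ?sqr_ge0.
  have q0 : 0 <= b i ^+ 2 * A by rewrite mulr_ge0 ?sqr_ge0.
  rewrite (le_trans (ler_norm _)) // -(@ler_pXn2r _ 2) ?nnegrE ?addr_ge0 //.
  rewrite real_normK ?num_real //.
  have := ler_wpM2l (sqr_ge0 (a i * b i)) IH.
  have := sqr_ge0 (a i ^+ 2 * B - b i ^+ 2 * A); nra.
nra.
Qed.

(** * The Schur product estimate *)

Section SchurProduct.
Context {R : realType} {H : hilbertType R} {J : choiceType}.
Variables (e : J -> H -> H) (S : J -> J -> R[i]) (A : J -> J -> H -> H).
Hypothesis e_proj : pairwise_orthogonal_projections e.
Hypothesis A_corner : forall i j, corner (e i) (e j) (A i j).
Implicit Types (x u : H) (F G : {fset J}).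

Lemma row_norm_bound i F : row_bounded S ->
  \sum_(j <- F) rnorm (S i j) ^+ 2 <= row_norm S ^+ 2.
Proof.
(* Pairing the row index with the finite set gives the single index that [inf_sqr_bounds]
   expects. *)
pose f (p : J * {fset J}) := \sum_(j <- p.2) rnorm (S p.1 j) ^+ 2.
have rowE : row_bounds S = [set C | 0 <= C /\ forall p, f p <= C ^+ 2].
  have sumE k G : \sum_(j <- G) `|S k j| ^+ 2 = (f (k, G))%:C.
    by rewrite rmorph_sum; apply: eq_bigr => j _; rewrite rnormE rmorphXn.
  apply/seteqP; split=> C [C0 CS]; split=> //; [move=> [k G]|move=> k G].
    by have := CS k G; rewrite sumE lecR.
  by rewrite sumE lecR; exact: CS.
rewrite /row_bounded /row_norm rowE => /(@inf_sqr_bounds _ _ f)[_ fle].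
exact: fle (i, F).
Qed.

Lemma row_norm_ge0 : row_bounded S -> 0 <= row_norm S.
Proof. by move=> S_row; apply: lb_le_inf => // C []. Qed.

Lemma col_norm_ge0 : col_bounded A -> 0 <= col_norm A.
Proof. by move=> A_col; apply: lb_le_inf => // C []. Qed.

Lemma corner_bounded i j : bounded_op (A i j).
Proof.
have [y yb <-] := A_corner i j.
apply: bounded_op_comp (proj_bounded e_proj j).
exact: bounded_op_comp (proj_bounded e_proj i) yb.
Qed.

Lemma corner_projE i j x : e i (A i j (e j x)) = A i j x.
Proof. by have [y _ <-] := A_corner i j; rewrite /= !proj_proj // !eqxx. Qed.

(** The left side equals <u, T u>, where T is the sum of the adjoint products; Cauchy-Schwarz and
    the bound on the norm of T conclude. *)
Lemma col_norm_bound j F u : col_bounded A ->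
  \sum_(i <- F) rnorm (A i j u) ^+ 2 <= col_norm A ^+ 2 * rnorm u ^+ 2.
Proof.
move=> A_col; pose T G k := \sum_(i <- G) (adjoint (A i k) \o A i k : H -> H).
have T_bounded : bounded_op (T F j).
  apply: bounded_op_sum => i.
  have Ab := corner_bounded i j.
  exact: bounded_op_comp (bounded_op_adjoint Ab) Ab.
have T_norm : op_norm (T F j) <= col_norm A ^+ 2.
  pose f (p : J * {fset J}) := op_norm (T p.2 p.1).
  have colE : col_bounds A = [set C | 0 <= C /\ forall p, f p <= C ^+ 2].
    apply/seteqP; split=> C [C0 CA]; split=> //; [move=> [k G]|move=> k G].
      exact: CA.
    exact: CA (k, G).
  move: A_col; rewrite /col_bounded /col_norm colE.
  by move=> /(@inf_sqr_bounds _ _ f)[_ fle]; exact: fle (j, F).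
have -> : \sum_(i <- F) rnorm (A i j u) ^+ 2 = complex.Re (inner u (T F j u)).
  rewrite /T fct_sumE inner_sumr raddf_sum; apply: eq_bigr => i _ /=.
  by rewrite -adjointE ?innerxx //; exact: corner_bounded.
rewrite (le_trans (ler_Re_inner _ _)) // mulrC (expr2 (rnorm u)) mulrA.
rewrite ler_wpM2r ?rnorm_ge0 // (le_trans (rnorm_op _ T_bounded)) //.
by rewrite ler_wpM2r ?rnorm_ge0.
Qed.

Lemma schur_block_bound F x : row_bounded S -> col_bounded A ->
  rnorm (block (schur_product S A) F F x) <= row_norm S * col_norm A * rnorm x.
Proof.
move=> S_row A_col; have r0 := row_norm_ge0 S_row; have c0 := col_norm_ge0 A_col.
rewrite -(@ler_pXn2r _ 2) ?nnegrE ?mulr_ge0 ?rnorm_ge0 //.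
rewrite (rnorm_sum_orthogonal e_proj) => [|i]; last first.
  rewrite (lin_sum _ _ (proj_lin e_proj i)); apply: eq_bigr => j _.
  rewrite /schur_product !scalrfctE (linZ _ _ (proj_lin e_proj i)).
  by rewrite -corner_projE proj_proj // eqxx.
(* Cauchy-Schwarz within a row. Each entry is applied to [e j x] instead of [x], so that the column
   bounds later produce the sum of |e j x|^2, which stays below |x|^2. *)
have row_le i : rnorm (\sum_(j <- F) schur_product S A i j x) ^+ 2 <=
    row_norm S ^+ 2 * \sum_(j <- F) rnorm (A i j (e j x)) ^+ 2.
  apply: (@le_trans _ _
    ((\sum_(j <- F) rnorm (S i j) * rnorm (A i j (e j x))) ^+ 2)).
    rewrite ler_pXn2r ?nnegrE ?rnorm_ge0 //; last first.
      by apply: sumr_ge0 => j _; rewrite mulr_ge0 ?rnorm_ge0.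
    rewrite (le_trans (ler_rnorm_sum _ _)) //; apply: ler_sum => j _.
    rewrite /schur_product scalrfctE rnormZ -(corner_projE i j (e j x)).
    by rewrite proj_proj // eqxx corner_projE.
  rewrite (le_trans (sum_cauchy_schwarz _ _ _)) // ler_wpM2r ?row_norm_bound //.
  by apply: sumr_ge0 => j _; exact: sqr_ge0.
apply: (le_trans (ler_sum _ (fun i _ => row_le i))).
(* Exchanging the sums collects, for each [j], a whole column acting on the single vector
   [e j x]. *)
rewrite -mulr_sumr exchange_big /= !exprMn -mulrA ler_wpM2l ?sqr_ge0 //.
apply: (@le_trans _ _ (\sum_(j <- F) col_norm A ^+ 2 * rnorm (e j x) ^+ 2)).
  by apply: ler_sum => j _; exact: col_norm_bound.
rewrite -mulr_sumr ler_wpM2l ?sqr_ge0 // rnorm_psum //.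
by rewrite ler_pXn2r ?nnegrE ?rnorm_ge0 // rnorm_psum_le.
Qed.

End SchurProduct.

Theorem corollary2p4 (R : realType) (H : hilbertType R) (J : choiceType)
    (e : J -> H -> H) (S : J -> J -> R[i]) (A : J -> J -> H -> H)
    (e_proj : pairwise_orthogonal_projections e)
    (e_sum : strong_sum e idfun)
    (A_corner : forall i j, corner (e i) (e j) (A i j))
    (S_row : row_bounded S) (A_col : col_bounded A) :
  bounded_mx e (schur_product S A) /\
  mx_norm e (schur_product S A) <= row_norm S * col_norm A.
Proof.
have X_lin i j : linear (schur_product S A i j).
  exact/bounded_op_lin/bounded_opZ/(corner_bounded e_proj A_corner).
have X_corner i j x :
    e i (schur_product S A i j (e j x)) = schur_product S A i j x.
  rewrite /schur_product !scalrfctE (linZ _ _ (proj_lin e_proj i)).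
  by rewrite (corner_projE e_proj A_corner).
have K_ge0 : 0 <= row_norm S * col_norm A.
  by rewrite mulr_ge0 ?row_norm_ge0 ?col_norm_ge0.
have X_bound F x := schur_block_bound e_proj A_corner F x S_row A_col.
split.
  exact: (bounded_mx_blocks e_proj e_sum X_lin X_corner K_ge0 X_bound).
exact: (mx_norm_blocks e_proj e_sum X_lin X_corner K_ge0 X_bound).
Qed.
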